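(* Let $(\xi_n)_{n\ge 1}$ be a sequence of independent identically distributed random variables taking the values $0,1,2,3,4,5$ with probabilities $p_0,p_1,p_2,p_3,p_4,p_5$ respectively, where $p_i\ge 0$, $p_i<1$, $\sum_{i=0}^{5}p_i=1$, and let $\xi=\sum_{n=1}^{\infty}4^{-n}\xi_n$. If at least one of the conditions $$p_2\ne p_0+p_4\quad\text{or}\quad p_3\ne p_1+p_5$$ holds, then $\xi$ has a singular distribution on $\left[0,\frac53\right]$.
   Context: A random variable has a singular distribution if there is a Borel set of Lebesgue measure zero to which it belongs with probability $1$. ''Distribution on a set'' means that the random variable takes values in that set with probability $1$. *)

(* Defs.v *)
From mathcomp Require Import all_boot all_order all_algebra finmap.
From mathcomp Require Import all_classical all_reals all_analysis.

Set Implicit Arguments.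
Unset Strict Implicit.
Unset Printing Implicit Defensive.

Import Order.TTheory GRing.Theory Num.Theory.
Import numFieldNormedType.Exports.

Local Open Scope classical_set_scope.
Local Open Scope ring_scope.

Definition mutually_independent d d' (T : measurableType d)
    (T' : measurableType d') (R : realType) (P : probability T R)
    (I : choiceType) (D : set I) (X : I -> {RV P >-> T'}) : Prop :=
  forall (J : {fset I}) (A : I -> set T'),
    [set` J] `<=` D -> (forall i, i \in J -> measurable (A i)) ->
    P (\bigcap_(i in [set` J]) (X i @^-1` A i)) =
    (\prod_(i <- J) P (X i @^-1` A i))%E.
Arguments mutually_independent {d d' T T' R} P {I} D X.

(* Discrete distributions are singular in this sense: no continuity is
   required. *)
Definition singular_distribution d (T : measurableType d) (R : realType)
    (P : probability T R) (X : {RV P >-> R}) : Prop :=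
  exists B : set R, [/\ measurable B, lebesgue_measure B = 0%E &
    distribution P X B = 1%E].
Arguments singular_distribution {d T R} P X.

Definition distribution_on d (T : measurableType d) (R : realType)
    (P : probability T R) (X : {RV P >-> R}) (B : set R) : Prop :=
  distribution P X B = 1%E.
Arguments distribution_on {d T R} P X B.

(* Main.v *)
(* Let f be the characteristic function of xi. Since 4 xi = xi_1 + xi' with xi' a
   copy of xi independent of xi_1, f(2 pi) is the product of
     E exp(i pi xi_1 / 2) = (p0 + p4 - p2) + i (p1 + p5 - p3)
   and f(pi / 2). The first factor is nonzero by hypothesis, the second because
   pi xi / 2 lies in [0, 5 pi / 6], inside an open half plane after rotation. For
   uniform digits 0, 1, 2, 3, that is for Lebesgue measure, the first factor is 0.
   So for a suitable 1-periodic trigonometric g the averages of g(4^m x) over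
   sparse m concentrate near a positive constant under the law of xi and near 0
   under Lebesgue measure. Both are Chebyshev bounds for disjoint blocks of
   digits, the digits below a block being a small perturbation. This yields sets
   of small Lebesgue measure and of probability close to 1, and their upper limit
   along a summable sequence of errors carries xi and is a null set. *)

Require Import Defs.
From mathcomp Require Import all_boot all_order all_algebra finmap.
From mathcomp Require Import all_classical all_reals all_analysis.
From mathcomp Require Import ring lra zify.

Set Implicit Arguments.
Unset Strict Implicit.
Unset Printing Implicit Defensive.

Import Order.TTheory GRing.Theory Num.Theory.
Import numFieldNormedType.Exports.

Local Open Scope classical_set_scope.
Local Open Scope ring_scope.

(** * Words of base-4 digits *)

(* Most significant digit first. *)
Fixpoint word_value (s : seq nat) : nat :=
  if s is i :: t then (i * 4 ^ size t + word_value t)%N else 0%N.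

Definition word (N : nat) (s : seq nat) : bool :=
  (size s == N) && all (fun i => i < 6)%N s.

Lemma word_value_cat (s t : seq nat) :
  word_value (s ++ t) = (word_value s * 4 ^ size t + word_value t)%N.
Proof.
elim: s => //= i s ->.
by rewrite size_cat expnD mulnDl addnA mulnA.
Qed.

(** Equality holds for the word of [N] digits 5, of value [5 (4^N - 1) / 3]. The digits 4 and 5 let
    a value exceed [4^N]. *)
Lemma word_value_le (N : nat) (s : seq nat) :
  word N s -> (3 * word_value s + 5 <= 5 * 4 ^ N)%N.
Proof.
elim: s N => [|i s IH] [|N] //= /andP[/=]; rewrite eqSS => sz /andP[i6 h].
have := IH N; rewrite /word sz h => /(_ isT); rewrite (eqP sz) expnS.
nia.
Qed.

(** * Expectation over finitely many independent digits *)

Section Expectation.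
Variable R : realType.
Implicit Types (p : nat -> R) (f g : seq nat -> R).

(** A recursion on the first digit, in place of a product measure, so that one operator serves both
    the law of the digits and the uniform law on 0, 1, 2, 3. *)
Fixpoint expect p (N : nat) f : R :=
  if N is n.+1 then \sum_(i < 6) p i * expect p n (fun s => f (nat_of_ord i :: s))
  else f [::].

Lemma eq_expect p N f g :
  (forall s, word N s -> f s = g s) -> expect p N f = expect p N g.
Proof.
elim: N f g => [|N IH] f g fg /=; first exact: fg.
apply: eq_bigr => i _; congr (_ * _); apply: IH => s /andP[/eqP sz h].
by apply: fg; rewrite /word /= sz eqxx ltn_ord.
Qed.

Lemma ler_expect p N f g : (forall i, (i < 6)%N -> 0 <= p i) ->
  (forall s, word N s -> f s <= g s) -> expect p N f <= expect p N g.
Proof.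
move=> p0; elim: N f g => [|N IH] f g fg /=; first exact: fg.
apply: ler_sum => i _; apply: ler_wpM2l; first exact: p0.
apply: IH => s /andP[/eqP sz h].
by apply: fg; rewrite /word /= sz eqxx ltn_ord.
Qed.

Lemma expectD p N f g :
  expect p N (fun s => f s + g s) = expect p N f + expect p N g.
Proof.
elim: N f g => [//|N IH] f g /=; rewrite -big_split /=.
by apply: eq_bigr => i _; rewrite -mulrDr -IH.
Qed.

Lemma expectZ p N c f : expect p N (fun s => c * f s) = c * expect p N f.
Proof.
elim: N f => [//|N IH] f /=; rewrite mulr_sumr.
by apply: eq_bigr => i _; rewrite mulrCA -IH.
Qed.

Lemma expect_cst p N c : \sum_(i < 6) p i = 1 -> expect p N (fun=> c) = c.
Proof.
move=> p1; elim: N => [//|N IH] /=.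
by under eq_bigr do rewrite IH; rewrite -mulr_suml p1 mul1r.
Qed.

Lemma expect_cat p M N f : expect p (M + N) f =
  expect p M (fun s => expect p N (fun t => f (s ++ t))).
Proof. by elim: M f => [//|M IH] f /=; apply: eq_bigr => i _; rewrite IH. Qed.

Lemma expect_sum p N n (F : 'I_n -> seq nat -> R) :
  expect p N (fun s => \sum_i F i s) = \sum_i expect p N (F i).
Proof.
elim: N F => [//|N IH] F /=; rewrite exchange_big /=.
by apply: eq_bigr => i _; rewrite -mulr_sumr -IH.
Qed.

Lemma expectB1 p N (A : pred (seq nat)) : \sum_(i < 6) p i = 1 ->
  expect p N (fun s => (A s)%:R) = 1 - expect p N (fun s => (~~ A s)%:R).
Proof.
move=> p1; apply/eqP; rewrite eq_sym subr_eq -expectD eq_sym; apply/eqP.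
rewrite -[RHS](expect_cst N 1 p1).
by apply: eq_expect => s _; case: (A s); rewrite /= ?addr0 ?add0r.
Qed.

Fixpoint block_sum f (J B : nat) (s : seq nat) : R :=
  if B is b.+1 then f (take J s) + block_sum f J b (drop J s) else 0.

(** Disjoint blocks are independent and centred, so the cross terms vanish and second moments
    add. *)
Lemma expect_block_sum_sqr p J B f K :
  (forall i, (i < 6)%N -> 0 <= p i) -> \sum_(i < 6) p i = 1 ->
  (forall s, word J s -> `|f s| <= K) -> expect p J f = 0 ->
  expect p (B * J) (fun s => block_sum f J B s ^+ 2) <= B%:R * K ^+ 2.
Proof.
move=> p0 p1 fK f0; elim: B => [|B IH]; first by rewrite /= expr0n /= mul0r.
rewrite mulSn expect_cat.
set X := block_sum f J B in IH.
(* With the first block [s] fixed, the square is averaged over the other blocks; the cross term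
   becomes a constant times [f s], which has mean 0. *)
rewrite (@eq_expect p J _ (fun s => f s ^+ 2 +
   (2 * expect p (B * J) X * f s + expect p (B * J) (fun t => X t ^+ 2))));
  last first.
  move=> s /andP[/eqP sz _].
  rewrite (@eq_expect p _ _ (fun t => f s ^+ 2 + (2 * f s * X t + X t ^+ 2))).
    by rewrite !expectD expect_cst // expectZ; ring.
  by move=> t _ /=; rewrite take_size_cat // drop_size_cat // -/(X t); ring.
rewrite !expectD expectZ f0 mulr0 add0r expect_cst // -natr1 mulrDl mul1r addrC.
apply: lerD => //; rewrite -(expect_cst J (K ^+ 2) p1).
apply: ler_expect => // s ws; rewrite -real_normK ?num_real //.
by rewrite lerXn2r ?nnegrE ?(le_trans _ (fK _ ws)) // fK.
Qed.

(** Chebyshev's inequality: the indicator of [A] is at most [f^2 / a^2] on every word. *)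
Lemma expect_markov p N (A : pred (seq nat)) f a :
  (forall i, (i < 6)%N -> 0 <= p i) -> 0 < a ->
  (forall s, word N s -> A s -> a <= `|f s|) ->
  expect p N (fun s => (A s)%:R) <= a ^- 2 * expect p N (fun s => f s ^+ 2).
Proof.
move=> p0 a0 fa; rewrite -expectZ; apply: ler_expect => // s ws.
case/boolP: (A s) => [As|_]; last by rewrite mulr_ge0 ?sqr_ge0 // invr_ge0 sqr_ge0.
rewrite mulrC ler_pdivlMr ?exprn_gt0 // mul1r -(real_normK (num_real (f s))).
by rewrite lerXn2r ?nnegrE ?normr_ge0 ?(ltW a0) ?fa.
Qed.

Lemma sum_nat_split k n (F : nat -> R) : \sum_(0 <= v < k * n) F v =
  \sum_(i < k) \sum_(0 <= v < n) F (i * n + v)%N.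
Proof.
elim: k => [|k IH]; first by rewrite mul0n !big_ord0 big_geq.
rewrite big_ord_recr -IH mulSn addnC /=.
rewrite (@big_cat_nat _ _ _ (k * n)) ?leq_addr //=; congr (_ + _).
rewrite -{1}[(k * n)%N]add0n big_addn addKn.
by apply: eq_bigr => v _; rewrite addnC.
Qed.

(** With digits 4 and 5 of weight 0, each integer below [4^N] has exactly one expansion, so the
    value is uniform. This is the discrete form of Lebesgue measure. *)
Lemma expect_uniform N (F : nat -> R) :
  expect (fun i => if (i < 4)%N then 4^-1 else 0) N (fun s => F (word_value s)) =
  4 ^- N * \sum_(0 <= v < 4 ^ N) F v.
Proof.
elim: N F => [|N IH] F; first by rewrite /= expr0 invr1 mul1r expn0 big_nat1.
rewrite /= !big_ord_recr big_ord0 /= !mul0r !addr0 add0r.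
rewrite expnS sum_nat_split !big_ord_recr big_ord0 /= add0r.
have H i : expect (fun i => if (i < 4)%N then 4^-1 else 0) N
   (fun s => F (i * 4 ^ size s + word_value s)%N) =
   4 ^- N * \sum_(0 <= v < 4 ^ N) F (i * 4 ^ N + v)%N.
  rewrite -(IH (fun v => F (i * 4 ^ N + v)%N)).
  by apply: eq_expect => s /andP[/eqP-> _].
by rewrite !H exprS invfM; ring.
Qed.

End Expectation.

(** * Concentration of block sums *)

Section Deviation.
Variables (R : realType) (g : R -> R) (L K : R).
Hypothesis g_periodic : forall x n, g (x + n%:R) = g x.
Hypothesis g_bounded : forall x, `|g x| <= K.
Hypothesis L_ge0 : 0 <= L.
Hypothesis g_lipschitz : forall x y, `|g x - g y| <= L * `|x - y|.

(** With [x = v / 4^(J B)], the terms are the values of [g] at [4^(J l) x] for [0 <= l < B]. *)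
Definition freq_sum (J B v : nat) : R := \sum_(k < B) g (v%:R / 4 ^+ (J * k.+1)).

Lemma freq_sum_periodic J B m u v : (B * J <= m)%N ->
  freq_sum J B (u * 4 ^ m + v) = freq_sum J B v.
Proof.
move=> hm; apply: eq_bigr => -[k /= kB] _.
have hk : (J * k.+1 <= m)%N.
  by rewrite (leq_trans _ hm) // mulnC leq_mul2r kB orbT.
rewrite -(subnK hk) -(g_periodic (v%:R / _) (u * 4 ^ (m - J * k.+1))).
congr g; rewrite expnD natrD !natrM !natrX mulrDl addrC; congr (_ + _).
by rewrite mulrA mulfK // expf_neq0.
Qed.

(** In each term the digits above the block drop out by periodicity, and those below it move the
    argument by at most [2 / 4^J]. *)
Lemma freq_sum_block_sum (c : R) J B s : word (B * J) s ->
  `|freq_sum J B (word_value s) - B%:R * c -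
    block_sum (fun u => g ((word_value u)%:R / 4 ^+ J) - c) J B s|
  <= B%:R * (2 * L / 4 ^+ J).
Proof.
elim: B s => [|B IH] s ws.
  by rewrite /freq_sum big_ord0 /= !mul0r !subr0 normr0.
rewrite /=; move: ws; rewrite mulSn => ws.
have /andP[/eqP sz al] := ws.
have Js : (J <= size s)%N by rewrite sz leq_addr.
have wd : word (B * J) (drop J s).
  rewrite /word size_drop sz addKn eqxx /=.
  by move: al; rewrite -{1}(cat_take_drop J s) all_cat => /andP[].
have {IH} := IH _ wd.
have -> : word_value s = (word_value (take J s) * 4 ^ size (drop J s) +
    word_value (drop J s))%N by rewrite -word_value_cat cat_take_drop.
move: (take J s) (drop J s) wd => u t wt.
rewrite /freq_sum big_ord_recr /= -!/(freq_sum _ _ _).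
have /andP[/eqP-> _] := wt.
rewrite freq_sum_periodic //.
set X := block_sum _ _ _ _ => IH.
(* The last frequency reads the top block [u]; the tail [t] has value at most [2 * 4^(B J)], hence
   the factor 2. *)
have E : `|g ((word_value u * 4 ^ (B * J) + word_value t)%:R / 4 ^+ (J * B.+1))
         - g ((word_value u)%:R / 4 ^+ J)| <= 2 * L / 4 ^+ J.
  apply: (le_trans (g_lipschitz _ _)).
  rewrite -mulrA [2 * _]mulrC -mulrA; apply: ler_wpM2l => //.
  have -> : (word_value u * 4 ^ (B * J) + word_value t)%:R / 4 ^+ (J * B.+1) -
      (word_value u)%:R / 4 ^+ J =
      (word_value t)%:R / 4 ^+ (B * J) / 4 ^+ J :> R.
    rewrite natrD natrM natrX mulnS exprD mulnC.
    by field; rewrite !expf_neq0.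
  rewrite normrM normfV (@ger0_norm _ (4 ^+ J)) ?exprn_ge0 //.
  rewrite [leLHS]mulrC; apply: ler_wpM2l; first by rewrite invr_ge0 exprn_ge0.
  rewrite ger0_norm ?divr_ge0 ?exprn_ge0 // ler_pdivrMr ?exprn_gt0 //.
  have := word_value_le wt; rewrite -(ler_nat R) -natrX -natrM ler_nat ler_nat.
  by lia.
rewrite -[B.+1%:R]natr1 [in leRHS]mulrDl [in leRHS]mul1r.
apply: (le_trans _ (lerD IH E)); apply: (le_trans _ (ler_normD _ _)).
by rewrite le_eqVlt; apply/orP; left; apply/eqP; congr `| _ |; ring.
Qed.

(** Half of the deviation [B delta / 2] absorbs the lower digits, which contribute at most
    [2 L / 4^J <= delta / 4] per block. Chebyshev, with the bound [2 K] for a centred block, handles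
    the other half; the constant is [64 = 4 * 16]. *)
Lemma freq_sum_deviation (p : nat -> R) J B (c delta : R) :
  (forall i, (i < 6)%N -> 0 <= p i) -> \sum_(i < 6) p i = 1 ->
  expect p J (fun s => g ((word_value s)%:R / 4 ^+ J)) = c ->
  0 < delta -> (0 < B)%N -> 8 * L <= delta * 4 ^+ J ->
  expect p (B * J) (fun s =>
    (B%:R * delta / 2 <= `|freq_sum J B (word_value s) - B%:R * c|)%R%:R) <=
  64 * K ^+ 2 / (B%:R * delta ^+ 2).
Proof.
move=> p0 p1 Ec d0 B0 hJ.
have B0R : 0 < B%:R :> R by rewrite ltr0n.
pose f := fun u => g ((word_value u)%:R / 4 ^+ J) - c.
have f0 : expect p J f = 0.
  by rewrite expectD Ec expect_cst // subrr.
have cK : `|c| <= K.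
  rewrite -Ec ler_norml; apply/andP; split.
    rewrite -(expect_cst J (- K) p1); apply: ler_expect => // s _.
    by have := g_bounded ((word_value s)%:R / 4 ^+ J); rewrite ler_norml => /andP[].
  rewrite -(expect_cst J K p1); apply: ler_expect => // s _.
  by have := g_bounded ((word_value s)%:R / 4 ^+ J); rewrite ler_norml => /andP[].
have fK s : word J s -> `|f s| <= 2 * K.
  move=> _; apply: (le_trans (ler_normB _ _)).
  by have := lerD (g_bounded ((word_value s)%:R / 4 ^+ J)) cK; lra.
have a0 : 0 < B%:R * delta / 4 by rewrite divr_gt0 ?mulr_gt0.
have A s : word (B * J) s ->
    B%:R * delta / 2 <= `|freq_sum J B (word_value s) - B%:R * c| ->
    B%:R * delta / 4 <= `|block_sum f J B s|.
  move=> ws h; have := freq_sum_block_sum c ws; rewrite -/f.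
  have : B%:R * (2 * L / 4 ^+ J) <= B%:R * delta / 4.
    rewrite -[leRHS]mulrA; apply: ler_wpM2l => //.
    rewrite ler_pdivrMr ?exprn_gt0 //; lra.
  have := lerB_normD (freq_sum J B (word_value s) - B%:R * c) (- block_sum f J B s).
  rewrite normrN; lra.
apply: (le_trans (expect_markov (A := fun s =>
  B%:R * delta / 2 <= `|freq_sum J B (word_value s) - B%:R * c|) p0 a0 A)).
have := expect_block_sum_sqr B p0 p1 fK f0.
have a2 : 0 < (B%:R * delta / 4) ^- 2 by rewrite invr_gt0 exprn_gt0.
rewrite -(ler_pM2l a2) => /le_trans; apply.
rewrite le_eqVlt; apply/orP; left; apply/eqP; field.
by rewrite !lt0r_neq0.
Qed.
End Deviation.

(** * The test function *)

Section Character.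
Variable R : realType.

Lemma lipschitz_of_derive (f df : R -> R) (x y : R) :
  (forall z : R, is_derive z 1 f (df z)) -> (forall z, `|df z| <= 1) ->
  `|f x - f y| <= `|x - y|.
Proof.
move=> fdf df1; wlog xy : x y / x <= y => [H|].
  by case/orP: (le_total x y) => /H //; rewrite distrC (distrC y).
have cf : {within `[x, y], continuous f}.
  apply: derivable_within_continuous => z _.
  by have [] := fdf z.
have [c _] := MVT_segment xy (fun z _ => fdf z) cf.
rewrite distrC (distrC x) => ->; rewrite normrM.
by rewrite -[leRHS]mul1r; apply: ler_wpM2r.
Qed.

Lemma cos_lipschitz (x y : R) : `|cos x - cos y| <= `|x - y|.
Proof.
apply: (@lipschitz_of_derive _ (fun z => - sin z)) => z.
by rewrite normrN sin_max.
Qed.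

Lemma sin_lipschitz (x y : R) : `|sin x - sin y| <= `|x - y|.
Proof.
apply: (@lipschitz_of_derive _ cos) => z.
exact: cos_max.
Qed.

(* The phase centres the values [pi * (y / 2 - 5 / 12)], [0 <= y <= 5 / 3], that
   [sum_wave] produces, so that their cosine stays positive. *)
Definition wave (a b x : R) : R :=
  a * cos (2 * pi * x - 5 / 12 * pi) + b * sin (2 * pi * x - 5 / 12 * pi).

Lemma wave_periodic a b x n : wave a b (x + n%:R) = wave a b x.
Proof.
rewrite /wave.
have -> : 2 * pi * (x + n%:R) - 5 / 12 * pi =
    2 * pi * x - 5 / 12 * pi + (pi *+ 2) *+ n :> R.
  by rewrite -mulrnA -[X in _ = _ + X]mulr_natr natrM; ring.
by rewrite (periodicn (@cosD2pi R)) (periodicn (@sinD2pi R)).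
Qed.

Lemma wave_bounded a b x : `|wave a b x| <= `|a| + `|b|.
Proof.
apply: (le_trans (ler_normD _ _)); rewrite !normrM.
by apply: lerD; rewrite -[leRHS]mulr1 ler_wpM2l ?cos_max ?sin_max.
Qed.

Lemma wave_lipschitz a b x y :
  `|wave a b x - wave a b y| <= 2 * pi * (`|a| + `|b|) * `|x - y|.
Proof.
rewrite /wave; set u := 2 * pi * x - _; set v := 2 * pi * y - _.
have uv : `|u - v| = 2 * pi * `|x - y|.
  have -> : u - v = 2 * pi * (x - y) by rewrite /u /v; ring.
  by rewrite normrM ger0_norm // mulr_ge0 ?pi_ge0.
have -> : a * cos u + b * sin u - (a * cos v + b * sin v) =
  a * (cos u - cos v) + b * (sin u - sin v) by ring.
have -> : 2 * pi * (`|a| + `|b|) * `|x - y| = `|a| * `|u - v| + `|b| * `|u - v|.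
  by rewrite uv; ring.
apply: (le_trans (ler_normD _ _)); rewrite !normrM.
by apply: lerD; apply: ler_wpM2l => //; [exact: cos_lipschitz|exact: sin_lipschitz].
Qed.

(* [u + i v] is the characteristic function of the digit law [r] at [pi / 2]. *)
Lemma sum_wave (r : nat -> R) a b y :
  let u := r 0 + r 4 - r 2 in let v := r 1 + r 5 - r 3 in
  let t := pi * (y / 2 - 5 / 12) in
  \sum_(i < 6) r i * wave a b ((i%:R + y) / 4) =
  (a * u + b * v) * cos t + (b * u - a * v) * sin t.
Proof.
move=> u v t; rewrite !big_ord_recr big_ord0 /= /wave.
(* Each unit of the first digit is a quarter turn: 0 and 4 agree, 1 and 5 agree, and 2 and 3 are
   their opposites. *)
have E i : 2 * pi * ((i%:R + y) / 4) - 5 / 12 * pi = t + (pi / 2) *+ i.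
  by rewrite -mulr_natr /t; field.
rewrite !E mulr0n mulr1n !mulrS mulr0n !addr0 !addrA.
rewrite !(cosDpihalf, sinDpihalf) /u /v; ring.
Qed.

(** Finite form of the self-similarity [4 xi = xi_1 + xi']. *)
Lemma expect_first_digit (r : nat -> R) J (g : R -> R) :
  expect r J.+1 (fun s => g ((word_value s)%:R / 4 ^+ J.+1)) =
  expect r J (fun s =>
    \sum_(i < 6) r i * g ((i%:R + (word_value s)%:R / 4 ^+ J) / 4)).
Proof.
rewrite expect_sum /=; apply: eq_bigr => i _; rewrite expectZ; congr (_ * _).
apply: eq_expect => s /andP[/eqP-> _]; congr g.
rewrite natrD natrM natrX exprS; field.
by rewrite expf_neq0.
Qed.

(** Truncated real form of the factorisation of [f(2 pi)] into the first-digit factor [u + i v] and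
    [f(pi / 2)], rotated by the phase. *)
Lemma expect_wave (r : nat -> R) J a b :
  let u := r 0 + r 4 - r 2 in let v := r 1 + r 5 - r 3 in
  let t s := pi * ((word_value s)%:R / 4 ^+ J / 2 - 5 / 12) in
  expect r J.+1 (fun s => wave a b ((word_value s)%:R / 4 ^+ J.+1)) =
  (a * u + b * v) * expect r J (fun s => cos (t s)) +
  (b * u - a * v) * expect r J (fun s => sin (t s)).
Proof.
move=> u v t; rewrite expect_first_digit -!expectZ -expectD.
by apply: eq_expect => s _; rewrite sum_wave.
Qed.

(** The coefficients [a = u], [b = v] cancel the sine term and leave [u^2 + v^2] times a mean of
    cosines. Their angles lie within [5 pi / 12] of 0, because [0 <= y <= 5 / 3]. *)
Lemma expect_wave_ge (r : nat -> R) (u v : R) J :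
  (forall i, (i < 6)%N -> 0 <= r i) -> \sum_(i < 6) r i = 1 ->
  u = r 0 + r 4 - r 2 -> v = r 1 + r 5 - r 3 ->
  (u ^+ 2 + v ^+ 2) * cos (5 / 12 * pi) <=
  expect r J.+1 (fun s => wave u v ((word_value s)%:R / 4 ^+ J.+1)).
Proof.
move=> r0 r1 uE vE; rewrite expect_wave.
rewrite -uE -vE [v * u]mulrC subrr mul0r addr0 -!expr2.
apply: ler_wpM2l; first by rewrite addr_ge0 ?sqr_ge0.
rewrite -(expect_cst J (cos _) r1); apply: ler_expect => // s ws.
set y : R := (word_value s)%:R / 4 ^+ J.
have y0 : 0 <= y by rewrite divr_ge0 ?exprn_ge0.
have y1 : y <= 5 / 3.
  rewrite ler_pdivrMr ?exprn_gt0 // -natrX mulrAC ler_pdivlMr // -!natrM ler_nat.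
  by have := word_value_le ws; lia.
have p0 := pi_gt0 R.
set t := pi * _.
have <- : cos `|t| = cos t.
  by case: (ler0P t) => h; rewrite ?(ger0_norm h) ?(ler0_norm h) ?cosN.
have ty : `|t| <= 5 / 12 * pi.
  rewrite /t normrM gtr0_norm // mulrC ler_pM2r // ler_norml; lra.
by rewrite leNgt ltr_cos ?in_itv /= ?normr_ge0 -?leNgt //; apply/andP; split; nra.
Qed.

End Character.

(** * Separation of the digit law from the uniform law *)

(** The witness [A] asks the frequency sum to reach [B delta / 2], halfway between the centre 0 for
    uniform digits and the lower bound [B delta] for the centre under [p]. *)
Lemma exists_separating_pred (R : realType) (p : nat -> R) (e : R) :
  (forall i, (i < 6)%N -> 0 <= p i) -> \sum_(i < 6) p i = 1 ->
  p 2%N <> p 0%N + p 4%N \/ p 3%N <> p 1%N + p 5%N -> 0 < e ->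
  exists N (A : pred nat),
    [/\ 1 - e <= expect p N (fun s => (A (word_value s))%:R),
        forall u v, A (u * 4 ^ N + v)%N = A v &
        4 ^- N * (\sum_(0 <= v < 4 ^ N) (A v)%:R) <= e].
Proof.
move=> p0 p1 pne e0.
pose u := p 0 + p 4 - p 2; pose v := p 1 + p 5 - p 3.
pose delta := (u ^+ 2 + v ^+ 2) * cos (5 / 12 * pi).
pose K := `|u| + `|v|; pose L := 2 * pi * K.
have pi0 := pi_gt0 R.
have delta0 : 0 < delta.
  rewrite mulr_gt0 ?cos_gt0_pihalf //; last by apply/andP; split; lra.
  case: pne => ne.
    by rewrite ltr_wpDr ?sqr_ge0 // exprn_even_gt0 //= subr_eq0 eq_sym; exact/eqP.
  by rewrite ltr_wpDl ?sqr_ge0 // exprn_even_gt0 //= subr_eq0 eq_sym; exact/eqP.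
have K0 : 0 <= K by rewrite addr_ge0.
have L0 : 0 <= L by rewrite /L mulr_ge0 // mulr_ge0 // ltW.
(* The block length is [j + 1]: large enough to control the lower digits, and positive so that a
   first digit can be split off. *)
have [j hj] : exists j, 8 * L <= delta * 4 ^+ j.+1.
  have [j hj] : exists j : nat, 8 * L / delta < j%:R.
    exists (Num.bound (8 * L / delta)); apply: archi_boundP.
    by apply: divr_ge0 (ltW delta0); apply: mulr_ge0.
  exists j; rewrite [leRHS]mulrC -ler_pdivrMr //; apply: (le_trans (ltW hj)).
  by rewrite -natrX ler_nat (leq_trans (ltnW (ltn_expl j (isT : 1 < 4)%N))) // leq_exp2l.
have [B B0 hB] : exists2 B, (0 < B)%N & 64 * K ^+ 2 / (B%:R * delta ^+ 2) <= e.
  have C0 : 0 <= 64 * K ^+ 2 / (delta ^+ 2 * e).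
    by apply: divr_ge0; apply: mulr_ge0; rewrite ?sqr_ge0 // (ltW e0).
  exists (Num.bound (64 * K ^+ 2 / (delta ^+ 2 * e))).+1 => //.
  have := archi_boundP C0; set b := Num.bound _ => hb.
  rewrite ler_pdivrMr; last by apply: mulr_gt0; rewrite ?ltr0n // exprn_gt0.
  have {}hb : 64 * K ^+ 2 / (delta ^+ 2 * e) <= b.+1%:R.
    by apply: (le_trans (ltW hb)); rewrite ler_nat.
  move: hb; rewrite ler_pdivrMr; last by rewrite mulr_gt0 // exprn_gt0.
  move=> /le_trans; apply.
  by rewrite le_eqVlt; apply/orP; left; apply/eqP; ring.
pose J := j.+1; pose g := wave u v.
have dev := @freq_sum_deviation R g L K (@wave_periodic R u v) (@wave_bounded R u v) L0
  (@wave_lipschitz R u v).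
exists (B * J)%N, (fun w => B%:R * delta / 2 <= freq_sum g J B w); split.
- rewrite (expectB1 _ (fun s => B%:R * delta / 2 <= freq_sum g J B (word_value s)) p1).
  rewrite lerD2l lerN2; apply: le_trans hB.
  set c := expect p J (fun s => g ((word_value s)%:R / 4 ^+ J)).
  have dc : delta <= c by exact: expect_wave_ge.
  have B0R : 0 < B%:R :> R by rewrite ltr0n.
  apply: le_trans (dev p J B c delta p0 p1 erefl delta0 B0 hj).
  (* Since [delta <= c], a sum below the threshold falls short of [B c] by at least
     [B delta / 2]. *)
  apply: ler_expect => // s _; rewrite ler_nat.
  case: leP => //= h; rewrite lt0b distrC.
  have : B%:R * delta <= B%:R * c by rewrite ler_pM2l.
  have := ler_norm (B%:R * c - freq_sum g J B (word_value s)); lra.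
- by move=> a b; rewrite freq_sum_periodic //; exact: wave_periodic.
- pose q : nat -> R := fun i => if (i < 4)%N then 4^-1 else 0.
  rewrite -(expect_uniform (B * J) (fun w => (B%:R * delta / 2 <= freq_sum g J B w)%R%:R)).
  rewrite -/q; apply: le_trans hB.
  have q0 i : (i < 6)%N -> 0 <= q i by move=> _; rewrite /q; case: ifP.
  have q1 : \sum_(i < 6) q i = 1 by rewrite !big_ord_recr big_ord0 /= /q /=; field.
  (* For uniform digits [q 0 + q 4 - q 2] and [q 1 + q 5 - q 3] are both 0. *)
  have qc : expect q J (fun s => g ((word_value s)%:R / 4 ^+ J)) = 0.
    by rewrite expect_wave /q /=; field.
  apply: le_trans (dev q J B 0 delta q0 q1 qc delta0 B0 hj).
  apply: ler_expect => // s _; rewrite ler_nat mulr0 subr0.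
  case: leP => //= h; rewrite lt0b.
  exact: le_trans (ler_norm _).
Qed.

(** * Null sets of full probability *)

(** Each tail union contains sets [C m] with [e m] arbitrarily small, so it has probability 1; the
    upper limit is the countable intersection of these unions. *)
Lemma probability_lim_sup_set d (T : measurableType d) (R : realType)
    (P : probability T R) (C : (set T)^nat) (e : R^nat) :
  (forall n, measurable (C n)) -> (forall n, ((1 - e n)%:E <= P (C n))%E) ->
  e @ \oo --> 0 -> P (lim_sup_set C) = 1%E.
Proof.
move=> mC PC e0.
have mU n : measurable (\bigcup_(j in [set j | (n <= j)%N]) C j).
  exact: bigcup_measurable.
have mL : measurable (lim_sup_set C) by exact: bigcapT_measurable.
suff nL : P.-negligible (~` lim_sup_set C).
  have : P (~` lim_sup_set C) = 0%E.
    by apply: measure_negligible => //; exact: measurableC.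
  rewrite probability_setC // => /eqP.
  by rewrite sube_eq ?fin_num_measure // ?fin_num_adde_defl // add0e => /eqP.
rewrite /lim_sup_set setC_bigcap; apply: negligible_bigcup => n.
apply/negligibleP; first exact: measurableC.
suff h : P (\bigcup_(j in [set j | (n <= j)%N]) C j) = 1%E.
  by rewrite -[LHS]/(P _) probability_setC // h subee.
apply/eqP; rewrite eq_le probability_le1 //=.
apply/lee_addgt0Pr => x x0.
near \oo => m.
have em : e m <= x.
  apply: ltW; near: m; exact: (cvgr_lt _ e0).
have nm : (n <= m)%N by near: m; exact: nbhs_infty_ge.
have h2 : ((1 - e m)%:E <= P (\bigcup_(j in [set j | (n <= j)%N]) C j))%E.
  apply: (le_trans (PC m)); apply: le_measure; rewrite ?inE //.
  exact: bigcup_sup.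
have : (1 <= (1 - e m)%:E + x%:E :> \bar R)%E.
  by rewrite -EFinD lee_fin; lra.
by move=> /le_trans; apply; apply: leeD.
Unshelve. all: by end_near.
Qed.

(** Sets with errors [2^-(n+1)] are chosen and their upper limit is taken: it is [mu]-null by
    Borel-Cantelli, and of full probability because the errors tend to 0. *)
Lemma null_full_set d (S : measurableType d) (R : realType)
    (mu : {measure set S -> \bar R}) d' (T : measurableType d')
    (P : probability T R) (X : T -> S) :
  (forall B, measurable B -> measurable (X @^-1` B)) ->
  (forall e : R, 0 < e -> exists B : set S,
     [/\ measurable B, (mu B <= e%:E)%E & ((1 - e)%:E <= P (X @^-1` B))%E]) ->
  exists B : set S, [/\ measurable B, mu B = 0%E & P (X @^-1` B) = 1%E].
Proof.
move=> mX H; pose e (n : nat) : R := 1 / (2 ^ n.+1)%:R.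
have /choice[B HB] : forall n, exists B : set S, [/\ measurable B,
    (mu B <= (e n)%:E)%E & ((1 - e n)%:E <= P (X @^-1` B))%E].
  by move=> n; apply: H; rewrite divr_gt0 // ltr0n expn_gt0.
have mB n : measurable (B n) by case: (HB n).
exists (lim_sup_set B); split.
- by apply: bigcapT_measurable => n; exact: bigcup_measurable.
- apply: lim_sup_set_cvg0 => //.
  apply: (@le_lt_trans _ _ (\sum_(0 <= n <oo) (e n)%:E)%E).
    by apply: lee_nneseries => n _ //; case: (HB n).
  by apply: (le_lt_trans (epsilon_trick0 xpredT ler01)); rewrite ltry.
- rewrite /lim_sup_set preimage_bigcap; under eq_bigcapr do rewrite preimage_bigcup.
  apply: (@probability_lim_sup_set _ _ _ _ _ e); first by move=> n; exact: mX.
    by move=> n; case: (HB n).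
  have -> : e = geometric (2^-1) (2^-1).
    by apply/funext => n; rewrite /e /geometric /= div1r natrX exprS invfM exprVn.
  by apply: cvg_geometric; rewrite ger0_norm // invf_lt1 // ltr1n.
Qed.

(** * Bounds for the series by its partial sums *)

Section Series.
Variables (R : realType) (x : nat -> R).
Hypothesis x05 : forall n, (1 <= n)%N -> 0 <= x n <= 5.

Let S n := \sum_(1 <= i < n) 4 ^- i * x i.

Lemma base4_series_bounds N :
  S N.+1 <= \big[+%R/0]_(1 <= n <oo) (4 ^- n * x n) <= S N.+1 + 5 / 3 / 4 ^+ N.
Proof.
(* The lower bounds increase and the upper bounds decrease with [N]. *)
have p4 n : 0 < 4 ^- n :> R by rewrite invr_gt0 exprn_gt0.
have S1 n : S n.+2 = S n.+1 + 4 ^- n.+1 * x n.+1 by rewrite /S big_nat_recr.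
have Sstep n : S n.+1 <= S n.+2.
  by rewrite S1 lerDl mulr_ge0 ?(ltW (p4 _)) //; case/andP: (x05 (isT : 1 <= n.+1)%N).
(* The constant [5 / 3] solves [5 + c = 4 c], so the upper bound is stationary when the new digit is
   5. *)
have Ustep n : S n.+2 + 5 / 3 * 4 ^- n.+1 <= S n.+1 + 5 / 3 * 4 ^- n.
  rewrite S1; have : 4 ^- n.+1 * x n.+1 <= 4 ^- n.+1 * 5.
    by rewrite ler_wpM2l ?(ltW (p4 _)) //; case/andP: (x05 (isT : 1 <= n.+1)%N).
  have -> : 4 ^- n = 4 * 4 ^- n.+1 :> R.
    by rewrite exprS invfM mulrA mulfV ?mul1r.
  lra.
have Sup n k : S n.+1 <= S (n + k).+1.
  by elim: k => [|k IH]; rewrite ?addn0 // addnS (le_trans IH).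
have Uup n k : S (n + k).+1 + 5 / 3 * 4 ^- (n + k) <= S n.+1 + 5 / 3 * 4 ^- n.
  by elim: k => [|k IH]; rewrite ?addn0 // addnS (le_trans (Ustep _)).
have S0 : S 0 = S 1 by rewrite /S !big_geq.
have ndS : nondecreasing_seq S.
  apply/nondecreasing_seqP => -[|n]; [by rewrite S0|exact: Sstep].
have SU n k : S k <= S n.+1 + 5 / 3 * 4 ^- n.
  apply: (@le_trans _ _ (S (n + k).+1)).
    by apply: ndS; rewrite leqW // leq_addl.
  by apply: le_trans (Uup n k); rewrite lerDl mulr_ge0 // ltW.
have cS : cvgn S.
  apply: nondecreasing_is_cvgn => //.
  by exists (S 1 + 5 / 3 * 4 ^- 0) => _ [k _ <-]; exact: SU.
apply/andP; split; first exact: nondecreasing_cvgn_le.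
by apply: limr_le => //; near=> k; exact: SU.
Unshelve. all: by end_near.
Qed.

Lemma base4_partial_sum s : (forall n, (n < size s)%N -> x n.+1 = (nth 0%N s n)%:R) ->
  \sum_(1 <= i < (size s).+1) 4 ^- i * x i = (word_value s)%:R / 4 ^+ size s.
Proof.
elim/last_ind: s => [|s i IH] h; first by rewrite big_geq //= mul0r.
rewrite size_rcons big_nat_recr //= IH; last first.
  move=> n ns; rewrite h ?size_rcons ?(ltn_trans ns) //; by rewrite nth_rcons ns.
rewrite h ?size_rcons // nth_rcons ltnn eqxx -cats1 word_value_cat /=.
rewrite expn1 muln1 addn0 natrD natrM exprS; field.
by rewrite expf_neq0.
Qed.

End Series.

(** * Law of the digits *)

Section DigitLaw.
Variables (R : realType) (d : measure_display) (T : measurableType d).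
Variables (P : probability T R) (p : nat -> R) (xi_ : nat -> {RV P >-> R}).
Hypothesis p_sum1 : \sum_(i < 6) p i = 1.
Hypothesis xi_indep : mutually_independent P [set n | (1 <= n)%N] xi_.
Hypothesis xi_distr : forall n i, (1 <= n)%N -> (i < 6)%N ->
  P (xi_ n @^-1` [set i%:R]) = (p i)%:E.

Definition cylinder (s : seq nat) : set T :=
  [set t | forall n, (n < size s)%N -> xi_ n.+1 t = (nth 0%N s n)%:R].

(** The shape that independence applies to: a finite intersection over the indices 1 to [size s],
    while positions in the word start at 0. *)
Lemma cylinderE s : cylinder s =
  \bigcap_(i in [set` seq_fset tt (iota 1 (size s))])
    (xi_ i @^-1` [set (nth 0%N s i.-1)%:R]).
Proof.
apply/seteqP; split => t h.
  by move=> i; rewrite /mkset seq_fsetE mem_iota; case: i => // i ns; exact: h.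
by move=> n ns; apply: (h n.+1); rewrite /mkset seq_fsetE mem_iota.
Qed.

Lemma measurable_digit n (i : nat) : measurable (xi_ n @^-1` [set i%:R : R]).
Proof. by apply: measurable_funPTI; exact: measurable_set1. Qed.

Lemma measurable_cylinder s : measurable (cylinder s).
Proof.
rewrite cylinderE; apply: fin_bigcap_measurable; first exact: finite_fset.
by move=> i _; exact: measurable_digit.
Qed.

Lemma probability_cylinder s : all (fun i => i < 6)%N s ->
  P (cylinder s) = (\prod_(i <- s) p i)%:E.
Proof.
move=> s6; rewrite cylinderE xi_indep; last 2 first.
- by move=> i; rewrite /mkset seq_fsetE mem_iota => /andP[].
- by move=> i _; exact: measurable_set1.
rewrite (perm_big _ (seq_fset_perm tt _)) /= undup_id ?iota_uniq //.
have -> : iota 1 (size s) = index_iota 1 (size s).+1.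
  by rewrite /index_iota subSS subn0.
rewrite big_add1 -prodEFin [RHS](big_nth 0%N) /=; apply: eq_big_nat => i /= si.
by rewrite xi_distr // (allP s6) // mem_nth.
Qed.

(** The prefix [u] of digits already fixed makes the induction on [N] follow the recursion of
    [expect]. *)
Definition word_event (N : nat) (A : pred (seq nat)) (u : seq nat) : set T :=
  [set t | exists s, [/\ word N s, A (u ++ s) & cylinder (u ++ s) t]].

Lemma word_event0 A u : word_event 0 A u = if A u then cylinder u else set0.
Proof.
apply/seteqP; split => t /=.
  by case=> s []; rewrite /word => /andP[/nilP-> _]; rewrite cats0 => ->.
by case: ifP => // Au ct; exists [::]; rewrite cats0.
Qed.

Lemma word_eventS N A u :
  word_event N.+1 A u = \big[setU/set0]_(i < 6) word_event N A (rcons u i).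
Proof.
rewrite -(bigcup_mkord _ (fun i => word_event N A (rcons u i))).
apply/seteqP; split => t /=.
  case=> -[|i s] [] //= /andP[/= sz /andP[i6 s6]] As cs.
  exists i => //=; exists s; rewrite cat_rcons; split => //.
  by rewrite /word -eqSS sz.
case=> i /= i6 [s []]; rewrite cat_rcons => /andP[/eqP sz s6] As cs.
by exists (i :: s); split => //; rewrite /word /= sz eqxx i6.
Qed.

Lemma measurable_word_event N A u : measurable (word_event N A u).
Proof.
elim: N u => [|N IH] u.
  by rewrite word_event0; case: ifP => // _; exact: measurable_cylinder.
by rewrite word_eventS; exact: bigsetU_measurable.
Qed.

(** Bridge from [P] to the finite expectations: independence gives the cylinders, and additivity
    over the next digit gives the induction step. *)
Lemma probability_word_event N A u : all (fun i => i < 6)%N u ->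
  P (word_event N A u) =
  ((\prod_(i <- u) p i) * expect p N (fun s => (A (u ++ s))%:R))%:E.
Proof.
elim: N u => [|N IH] u u6.
  rewrite word_event0 /= cats0; case: ifP => _; rewrite ?mulr0 ?measure0 //.
  by rewrite mulr1 probability_cylinder.
rewrite word_eventS measure_semi_additive_ord.
- rewrite /= mulr_sumr -sumEFin; apply: eq_bigr => i _.
  rewrite IH ?all_rcons ?ltn_ord //.
  rewrite -cats1 big_cat big_seq1 /= -mulrA; congr (_ * (_ * _))%:E.
  by apply: eq_expect => s _; rewrite -catA.
- by move=> i; exact: measurable_word_event.
(* The six pieces are disjoint, since they prescribe different digits at position [size u]. *)
- apply/trivIsetP => /= i j _ _ ij; rewrite -subset0 => t [] /=.
  have lt (k : 'I_6) s : (size u < size (rcons u k ++ s))%N.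
    by rewrite size_cat size_rcons leq_addr.
  have nu (k : 'I_6) s : nth 0%N (rcons u k ++ s) (size u) = k.
    by rewrite nth_cat size_rcons ltnS leqnn nth_rcons ltnn eqxx.
  move=> [s [_ _ /(_ _ (lt i s)) hs]] [s' [_ _ /(_ _ (lt j s')) hs']].
  move: ij; rewrite -val_eqE -(eqr_nat R).
  by move: hs; rewrite hs' !nu => ->; rewrite eqxx.
- by apply: bigsetU_measurable => i _; exact: measurable_word_event.
Qed.

(** The digits are real random variables known only through their law; the six values carry total
    mass 1. *)
Lemma ae_digits : {ae P, forall t n, (1 <= n)%N ->
  exists2 i, (i < 6)%N & xi_ n t = i%:R}.
Proof.
apply: ae_foralln => -[|n]; first exact: aeW.
pose E := \big[setU/set0]_(i < 6) (xi_ n.+1 @^-1` [set i%:R : R]).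
have mE : measurable E.
  by apply: bigsetU_measurable => i _; exact: measurable_digit.
have PE : P E = 1%E.
  rewrite measure_semi_additive_ord //; last first.
    apply/trivIsetP => /= i j _ _ ij; rewrite -subset0 => t [/= -> /eqP].
    by rewrite eqr_nat => /eqP/val_inj ji; move: ij; rewrite ji eqxx.
  transitivity (\sum_(i < 6) p i)%:E; last by rewrite p_sum1.
  by rewrite -sumEFin; apply: eq_bigr => i _; exact: xi_distr.
have : P.-negligible (~` E).
  apply/negligibleP; first exact: measurableC.
  by rewrite -[LHS]/(P _) probability_setC // PE subee.
apply: negligibleS => t /= h Et; apply: h => _; move: Et.
rewrite /E -(bigcup_mkord _ (fun i => xi_ n.+1 @^-1` [set i%:R : R])).
by move=> -[i /= i6 ->]; exists i.
Qed.

End DigitLaw.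

(** * Transfer to the real line and conclusion *)

Lemma ae_subset_le d (T : measurableType d) (R : realType)
    (mu : {measure set T -> \bar R}) (A B : set T) :
  measurable A -> measurable B -> {ae mu, forall t, A t -> B t} ->
  (mu A <= mu B)%E.
Proof.
move=> mA mB AB; have mD : measurable (A `\` B) by exact: measurableD.
have D0 : mu (A `\` B) = 0%E.
  apply: measure_negligible => //; apply: negligibleS AB => t [At nBt] /= h.
  exact/nBt/h.
rewrite -[leRHS]adde0 -D0; apply: (le_trans _ (measureU2 _ _ _)) => //.
apply: le_measure; rewrite ?inE //; first exact: measurableU.
by move=> t At; case: (pselect (B t)); [left|right].
Qed.

(** [B] is a union of intervals of length [5 / 3 / 4^N], the range of the tail after [N] digits.
    Grid points below [2 * 4^N] cover two periods of [A], whence [2 * 5 / 3 = 10 / 3]. *)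
Lemma lebesgue_grid (R : realType) (N : nat) (A : pred nat) (e : R) :
  (forall u v, A (u * 4 ^ N + v)%N = A v) ->
  4 ^- N * (\sum_(0 <= v < 4 ^ N) (A v)%:R) <= e ->
  exists B : set R, [/\ measurable B, (lebesgue_measure B <= (10 / 3 * e)%:E)%E &
    forall v x, (v < 2 * 4 ^ N)%N -> A v ->
      v%:R / 4 ^+ N <= x <= v%:R / 4 ^+ N + 5 / 3 / 4 ^+ N -> B x].
Proof.
move=> Aper Ae.
pose I v : set R := if A v then `[v%:R / 4 ^+ N, v%:R / 4 ^+ N + 5 / 3 / 4 ^+ N]%classic
  else set0.
have mI v : measurable (I v).
  by rewrite /I; case: ifP => _; [exact: measurable_itv|exact: measurable0].
exists (\big[setU/set0]_(v < 2 * 4 ^ N) I v); split.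
- by apply: bigsetU_measurable.
- have := @Boole_inequality _ R _ (@lebesgue_measure R) I (2 * 4 ^ N) (fun i _ => mI i).
  move=> /le_trans; apply.
  have muI v : lebesgue_measure (I v) = ((A v)%:R * (5 / 3 / 4 ^+ N))%:E.
    rewrite /I; case: ifP => _; last by rewrite measure0 mul0r.
    rewrite lebesgue_measure_itv /= lte_fin ltrDl divr_gt0 ?exprn_gt0 //.
    by rewrite -EFinD mul1r addrC addKr.
  rewrite (eq_bigr (fun v : 'I_(2 * 4 ^ N) => ((A v)%:R * (5 / 3 / 4 ^+ N))%:E)); last first.
    by move=> v _; exact: muI.
  rewrite sumEFin lee_fin -mulr_suml.
  rewrite -(big_mkord xpredT (fun v => (A v)%:R)) sum_nat_split.
  under eq_bigr do under eq_bigr do rewrite Aper.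
  rewrite sumr_const card_ord.
  have -> : (\sum_(0 <= v < 4 ^ N) (A v)%:R) *+ 2 * (5 / 3 / 4 ^+ N) =
    10 / 3 * (4 ^- N * \sum_(0 <= v < 4 ^ N) (A v)%:R) :> R.
    by rewrite -mulr_natl; ring.
  by rewrite ler_pM2l.
- move=> v x vN Av xv; rewrite -bigcup_mkord; exists v => //.
  by rewrite /I Av /= in_itv.
Qed.

Theorem theorem4 (R : realType) (d : measure_display) (T : measurableType d)
    (P : probability T R) (p : nat -> R)
    (xi_ : nat -> {RV P >-> R}) (xi : {RV P >-> R})
    (p_ge0 : forall i, (i < 6)%N -> 0 <= p i)
    (p_lt1 : forall i, (i < 6)%N -> p i < 1)
    (p_sum1 : \sum_(i < 6) p i = 1)
    (xi_indep : mutually_independent P [set n | (1 <= n)%N] xi_)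
    (xi_distr : forall n i, (1 <= n)%N -> (i < 6)%N ->
      P (xi_ n @^-1` [set i%:R]) = (p i)%:E)
    (xiE : {ae P, forall t,
      xi t = \big[+%R/0]_(1 <= n <oo) (4%:R ^- n * xi_ n t)}) :
  p 2%N <> p 0%N + p 4%N \/ p 3%N <> p 1%N + p 5%N ->
  singular_distribution P xi /\ distribution_on P xi `[0, 5%:R / 3%:R].
Proof.
move=> pne.
have bounds : {ae P, forall t N,
    \sum_(1 <= i < N.+1) 4 ^- i * xi_ i t <= xi t <=
    \sum_(1 <= i < N.+1) 4 ^- i * xi_ i t + 5 / 3 / 4 ^+ N}.
  apply: filterS2 xiE (ae_digits p_sum1 xi_distr) => t -> dig N.
  apply: base4_series_bounds => n n1; have [i i6 ->] := dig n n1.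
  by rewrite ler0n ler_nat -ltnS.
split; last first.
  apply/eqP; rewrite eq_le probability_le1 /=; last by apply: measurable_itv.
  rewrite -(probability_setT P); apply: ae_subset_le => //.
    by apply: measurable_funPTI; exact: measurable_itv.
  (* With no digit read, the bounds are 0 and [5 / 3]. *)
  apply: filterS bounds => t /(_ 0%N); rewrite big_geq // add0r expr0 divr1 => h _.
  by rewrite /= in_itv.
apply: (@null_full_set _ _ _ (@lebesgue_measure R) _ _ P xi) => [B mB|e e0].
  exact: measurable_funPTI.
(* The error [e / 4] leaves room for the factor [10 / 3] of the grid. *)
have e4 : 0 < e / 4 by rewrite divr_gt0.
have [N [A [hp Aper hq]]] := exists_separating_pred p_ge0 p_sum1 pne e4.
have [B [mB muB hB]] := lebesgue_grid Aper hq.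
exists B; split => //; first by apply: (le_trans muB); rewrite lee_fin; lra.
(* On [E] the first [N] digits form a word whose value satisfies [A], so almost surely [xi] lies in
   the grid interval of that value. *)
pose E := word_event xi_ N (fun s => A (word_value s)) [::].
have PE : P E = (expect p N (fun s => (A (word_value s))%:R))%:E.
  by rewrite (probability_word_event xi_indep xi_distr) // big_nil mul1r.
apply: (@le_trans _ _ (P E)); first by rewrite PE lee_fin; lra.
apply: ae_subset_le; first exact: measurable_word_event.
  exact: measurable_funPTI.
apply: filterS bounds => t /(_ N) h [s /= [ws As cs]].
have /andP[/eqP sz _] := ws.
apply: (hB (word_value s)) => //; last first.
  by rewrite -sz -(@base4_partial_sum _ (fun i => xi_ i t) s cs) sz.
(* The value is below [2 * 4^N], within the range of the grid. *)
have := word_value_le ws; lia.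
Qed.
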